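(* Let $G$ be a tree on $n$ vertices with $n\geq 4$, let $\overline{G}$ be its complement, and let $w$ and $\overline{w}$ be normalised weight functions on $E(G)$ and $E(\overline{G})$, respectively. (a) If $\overline{G}$ is also a tree, then $G$ and $\overline{G}$ are both isomorphic to the path $P_4$ on four vertices, and $$\frac{9}{2}\leq \mathrm{avec}(G,w)+\mathrm{avec}(\overline{G},\overline{w})\leq 6,\qquad \frac{81}{16}\leq \mathrm{avec}(G,w)\,\mathrm{avec}(\overline{G},\overline{w})\leq 9.$$ (b) If $n\geq 5$ and $\overline{G}$ is connected but not a tree, with size $\overline{m}$ and edge-connectivity $\overline{\lambda}$, then $$\frac{2(n-1)^2}{n(n-2)}\leq \mathrm{avec}(G,w)+\mathrm{avec}(\overline{G},\overline{w})\leq \frac{(n-1)\,[\,n+2(\overline{\lambda}-1)\,]}{2\overline{\lambda}}$$ and $$0\leq \mathrm{avec}(G,w)\,\mathrm{avec}(\overline{G},\overline{w})\leq \frac{\overline{m}(n-1)}{\overline{\lambda}}.$$ Moreover, the lower bound on the sum is attained (for some choice of normalised weight functions $w,\overline{w}$) if $G$ has $n-2$ end vertices, and the upper bound on the sum is attained (for some choice of normalised weight functions $w,\overline{w}$) if $G$ is the single broom $B_n$.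
   Context: Graphs are finite and simple; the size of a graph is its number of edges. For a connected graph $H$ with $n$ vertices and $m$ edges, a weight function is a map $w:E(H)\to\mathbb{R}^{\geq 0}$; it is called normalised if $\sum_{e\in E(H)}w(e)=m$. The weighted distance $d_w(u,v)$ is the minimum, over all paths between $u$ and $v$ in $H$, of the sum of the weights of the edges of the path. The weighted eccentricity of a vertex $v$ is $e_w(v)=\max_{u\in V(H)}d_w(u,v)$, and the average eccentricity is $\mathrm{avec}(H,w)=\frac1n\sum_{v\in V(H)}e_w(v)$. The edge-connectivity of $H$ is the smallest number of edges whose deletion disconnects $H$. The complement $\overline{G}$ of $G$ has the same vertex set as $G$, two distinct vertices being adjacent in $\overline{G}$ if and only if they are not adjacent in $G$. An end vertex of a tree is a vertex of degree $1$. The single broom $B_n=B(3,n-3)$ is the tree on $n$ vertices obtained from a path $P_3$ on three vertices by attaching $n-3$ new end vertices to one end vertex of the $P_3$. *)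

(* Defs.v *)
From mathcomp Require Import all_boot all_order all_algebra.
From mathcomp Require Import reals.

Set Implicit Arguments.
Unset Strict Implicit.
Unset Printing Implicit Defensive.

Import Order.TTheory GRing.Theory Num.Theory.
Local Open Scope ring_scope.

Record sgraph (T : finType) := SGraph {
  adj :> rel T;
  adj_sym : symmetric adj;
  adj_irr : irreflexive adj
}.

Section Graphs.
Variable T : finType.
Implicit Types (G : sgraph T) (F : {set {set T}}) (x y u v : T) (p : seq T).

Definition edges G : {set {set T}} := [set [set x; y] | x in T, y in T & G x y].

Definition degree G x : nat := #|[set y | G x y]|.

Definition end_vertices G : {set T} := [set x | degree G x == 1%N].

Definition connected G : bool := [forall x, forall y, connect G x y].

Definition acyclic G : Prop := forall c : seq T, (2 < size c)%N -> ~ ucycle G c.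

Definition tree G : Prop := connected G /\ acyclic G.

Definition compl_adj G : rel T := fun x y => (x != y) && ~~ G x y.

Fact compl_sym G : symmetric (compl_adj G).
Proof. by move=> x y; rewrite /compl_adj eq_sym adj_sym. Qed.

Fact compl_irr G : irreflexive (compl_adj G).
Proof. by move=> x; rewrite /compl_adj eqxx. Qed.

Definition complement G : sgraph T := SGraph (@compl_sym G) (@compl_irr G).

Definition del_adj G F : rel T := fun x y => G x y && ([set x; y] \notin F).

Fact del_sym G F : symmetric (del_adj G F).
Proof. by move=> x y; rewrite /del_adj adj_sym setUC. Qed.

Fact del_irr G F : irreflexive (del_adj G F).
Proof. by move=> x; rewrite /del_adj adj_irr. Qed.

Definition delete_edges G F : sgraph T := SGraph (@del_sym G F) (@del_irr G F).

Definition disconnecting G F : bool :=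
  (F \subset edges G) && ~~ connected (delete_edges G F).

(* On at least two vertices the default value edges G is itself
   disconnecting, so this is a genuine minimum. *)
Definition edge_connectivity G : nat :=
  #|[arg min_(F < edges G | disconnecting G F) #|F|]|.

(* The path is u :: p; it is simple, so p has at most #|T| vertices. *)
Definition is_path G u v p : bool :=
  [&& path G u p, last u p == v & uniq (u :: p)].

Definition path_edges u p : seq {set T} :=
  pairmap (fun x y => [set x; y]) u p.

End Graphs.

Section Weights.
Variables (R : realType) (T : finType).
Implicit Types (G : sgraph T) (u v : T) (w : {set T} -> R).

(* Weights are total functions on vertex sets; only the values on edges G
   are ever used. *)
Definition normalised G w : Prop :=
  (forall e, e \in edges G -> 0 <= w e)
  /\ \sum_(e in edges G) w e = #|edges G|%:R.

Definition path_weight w u (p : seq T) : R := \sum_(e <- path_edges u p) w e.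

(* The default value, the total weight, is at least the weight of every simple
   path, so it is irrelevant as soon as u and v are joined by a path: see
   wdist_min below. *)
Definition wdist G w u v : R :=
  \big[Order.min / \sum_(e in edges G) w e]_(p : #|T|.-bseq T | is_path G u v p)
    path_weight w u p.

(* Distances are nonnegative, so the default value 0 does not matter. *)
Definition wecc G w v : R := \big[Order.max / 0]_(u : T) wdist G w u v.

Definition avec G w : R := #|T|%:R^-1 * \sum_(v : T) wecc G w v.

End Weights.

Definition isomorphic (T U : finType) (G : sgraph T) (H : sgraph U) : Prop :=
  exists f : T -> U, bijective f /\ forall x y, H (f x) (f y) = G x y.

Definition sym_closure (T : finType) (a : rel T) : rel T :=
  fun x y => a x y || a y x.

Fact sym_closure_sym (T : finType) (a : rel T) : symmetric (sym_closure a).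
Proof. by move=> x y; rewrite /sym_closure orbC. Qed.

Definition path_arc n : rel 'I_n := fun i j => i.+1 == j :> nat.

Fact path_irr n : irreflexive (sym_closure (@path_arc n)).
Proof. by move=> i; rewrite /sym_closure /path_arc orbb gtn_eqF. Qed.

Definition path_graph n : sgraph 'I_n :=
  SGraph (sym_closure_sym _) (@path_irr n).

(* B(k, l): the path 0, ..., k-1 with l further vertices k, ..., k+l-1, all
   attached to its end vertex k-1. *)
Definition broom_arc k l : rel 'I_(k + l) := fun i j =>
  ((i.+1 == j :> nat) && (j < k)%N) || ((i.+1 == k) && (k <= j)%N).

Fact broom_irr k l : irreflexive (sym_closure (@broom_arc k l)).
Proof.
move=> i; rewrite /sym_closure /broom_arc orbb gtn_eqF //=.
by apply/negP=> /andP[/eqP eqk lek]; rewrite -{1}eqk ltnn in lek.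
Qed.

Definition broom k l : sgraph 'I_(k + l) :=
  SGraph (sym_closure_sym _) (@broom_irr k l).

Section Sanity.
Variables (R : realType) (T : finType).
Implicit Types (G : sgraph T) (u v : T) (w : {set T} -> R).

Lemma path_edges_sub G u p : path G u p -> {subset path_edges u p <= edges G}.
Proof.
elim: p u => [|x p IH] u //= /andP[ux xp] e; rewrite inE => /orP[/eqP->|].
  by apply/imset2P; exists u x => //; rewrite inE.
exact: IH.
Qed.

Lemma path_edges_uniq u (p : seq T) : uniq (u :: p) -> uniq (path_edges u p).
Proof.
elim: p u => [|x p IH] u //= /andP[]; rewrite inE negb_or => /andP[ux up] xp.
rewrite IH // andbT; apply/negP => /(nthP set0)[i].
rewrite size_pairmap => lti; rewrite (nth_pairmap u) //.
set y := nth u (x :: p) i; set z := nth u p i => eyz.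
have: u \in [set y; z] by rewrite eyz !inE eqxx.
have mz : z \in p by rewrite mem_nth.
have my : y \in x :: p by rewrite mem_nth //= ltnW.
rewrite !inE => /orP[] /eqP uE; last by rewrite uE mz in up.
by move: my; rewrite -uE inE (negPf ux) (negPf up).
Qed.

Lemma path_weight_le G w u v p : normalised G w -> is_path G u v p ->
  path_weight w u p <= \sum_(e in edges G) w e.
Proof.
move=> [w0 _] /and3P[Gp _ Up]; rewrite /path_weight.
rewrite big_uniq ?path_edges_uniq //= [leRHS](bigID (mem (path_edges u p))) /=.
rewrite (eq_bigl (fun e => (e \in edges G) && (e \in path_edges u p))).
  by rewrite lerDl sumr_ge0 // => e /andP[/w0].
move=> e /=; case: (boolP (e \in path_edges u p)); rewrite ?andbF ?andbT //.
by move/(path_edges_sub Gp) ->.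
Qed.

Lemma wdist_min G w u v : normalised G w -> connected G ->
  (exists2 p, is_path G u v p & path_weight w u p = wdist G w u v)
  /\ (forall p, is_path G u v p -> wdist G w u v <= path_weight w u p).
Proof.
move=> nw /forallP/(_ u)/forallP/(_ v)/connectP[q0 Gq0 vE].
have bs p : is_path G u v p -> (size p <= #|T|)%N.
  by case/and3P=> _ _ /card_uniqP /= sz; rewrite ltnW // -sz max_card.
have [p0 ip0] : exists p, is_path G u v p.
  case/shortenP: Gq0 vE => p Gp Up _ ->; exists p; exact/and3P.
split; last first.
  move=> p ip; rewrite /wdist.
  exact: (bigmin_le_cond _ (j := Bseq (bs _ ip))).
rewrite /wdist (bigmin_eq_arg _ (Bseq (bs _ ip0))) //=.
  by case: arg_minP => // p ip _; exists p.
by move=> p ip; exact: path_weight_le ip.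
Qed.

Lemma edge_connectivity_min G : (1 < #|T|)%N ->
  (exists2 F, disconnecting G F & #|F| = edge_connectivity G)
  /\ (forall F, disconnecting G F -> (edge_connectivity G <= #|F|)%N).
Proof.
move=> /card_gt1P[x [y [_ _ xy]]]; rewrite /edge_connectivity.
case: arg_minnP => [|F dF minF]; last by split=> [|F' /minF //]; exists F.
rewrite /disconnecting subxx /=; apply/negP => /forallP/(_ x)/forallP/(_ y).
case/connectP=> -[|z p] /= => [_ yE|/andP[/andP[Gxz] /negP[]]].
  by rewrite yE eqxx in xy.
by apply/imset2P; exists x z => //; rewrite inE.
Qed.

End Sanity.

(* Main.v *)
Require Import Defs.
From mathcomp Require Import all_boot all_order all_algebra.
From mathcomp Require Import reals.
From mathcomp Require Import zify ring lra.

Set Implicit Arguments.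
Unset Strict Implicit.
Unset Printing Implicit Defensive.

Import Order.TTheory GRing.Theory Num.Theory.
Local Open Scope ring_scope.

(** Write W for the number of edges of a connected graph, which is the total
    of a normalised weight function, and n for the number of vertices.

    Upper bounds. An eccentricity is at most W, since a simple path uses every
    edge at most once. It is also at most W divided by the edge-connectivity
    lambda. Indeed, let phi be the distance from a fixed vertex u; the value
    of phi changes by at most w e along an edge e. With the vertices sorted by
    phi, each initial segment is bounded by at least lambda edges; summing
    over the segments the gaps between consecutive values of phi, and
    exchanging the two summations, gives lambda * (max phi - min phi) <= W
    ([edge_connectivity_gap], [avec_le_edge_connectivity]). In a tree W = n - 1
    and in its complement W = (n - 1) * (n - 2) / 2, so the bounds on the
    sum and on the product follow by arithmetic.

    Lower bound. In a tree every edge is a bridge with an end vertex on each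
    side. The distance between two vertices is at least the total weight of
    the edges that separate them. Hence the distances from a vertex v to the
    k end vertices add up to at least W, so that v has eccentricity at least
    W / k. An edge that has a of the k end vertices on one side separates
    a * (k - a) >= k - 1 pairs of them, so that the eccentricities of the end
    vertices alone add up to at least 2 * W. If no vertex is adjacent to all
    the others, then k <= n - 2 and [tree_avec_ge] follows. The complement of
    the tree contributes at least 0.

    Extremal weights. When the complement is not a tree, it has an edge that
    is not a bridge, and putting all the weight there makes all distances 0;
    when k = n - 2, spreading the weight of the tree equally over its pendant
    edges attains the lower bound. Concentrating all the weight on a pendant
    edge gives every vertex the eccentricity W; a broom and its complement
    both have such an edge, so that the complement has edge-connectivity 1 and
    the upper bound is attained.

    If the complement is a tree as well, counting edges gives n = 4. Following
    the tree from an end vertex then exhibits an induced path on the four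
    vertices, and the bounds are those above for n = 4. *)

(** * Edges, cuts and separating edges *)

Section Combinatorics.
Variable T : finType.
Implicit Types (G : sgraph T) (e : {set T}) (F : {set {set T}}) (S : {set T}).
Implicit Types (x y u v : T) (p : seq T).

Lemma set2_inj x y a b : [set x; y] = [set a; b] ->
  (x = a /\ y = b) \/ (x = b /\ y = a).
Proof.
move=> E; have := set21 x y; have := set22 x y; rewrite {1 2}E.
have := set21 a b; have := set22 a b; rewrite -{1 2}E !inE.
by do 4![case/orP=> /eqP ?]; subst; auto.
Qed.

Lemma mem_edges G x y : ([set x; y] \in edges G) = G x y.
Proof.
apply/imset2P/idP => [[a b _]|Gxy]; last by exists x y; rewrite ?inE.
rewrite inE => /andP[_ Gab] /set2_inj[][-> ->] //.
by rewrite adj_sym.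
Qed.

Lemma edgesP G e : reflect (exists x y, e = [set x; y] /\ G x y) (e \in edges G).
Proof.
apply: (iffP idP) => [|[x [y [-> Gxy]]]]; last by rewrite mem_edges.
by case/imset2P=> x y _; rewrite inE => /andP[_ Gxy] ->; exists x, y.
Qed.

Lemma connect_adj_sym G x y : connect G x y = connect G y x.
Proof. exact: (sym_connect_sym (@adj_sym _ G)). Qed.

Lemma connectedP G x y : connected G -> connect G x y.
Proof. by move/forallP/(_ x)/forallP. Qed.

Lemma end_vertexP G x :
  reflect (exists y, forall z, G x z = (z == y)) (x \in end_vertices G).
Proof.
rewrite inE; apply: (iffP cards1P) => -[y Ey]; exists y.
  by move=> z; have := in_set1 z y; rewrite -Ey inE.
by apply/setP=> z; rewrite !inE Ey.
Qed.

Lemma connect_cross G S u v : connect G u v -> u \in S -> v \notin S ->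
  exists x y, [/\ x \in S, y \notin S & G x y].
Proof.
case/connectP=> p Gp ->; elim: p u Gp => [|z p IH] u /=; first by move=> _ ->.
case/andP=> Guz pz uS; case: (boolP (z \in S)) => zS; first exact: IH.
by exists u, z.
Qed.

Lemma path_delete G F u p : path G u p ->
  {in path_edges u p, forall e, e \notin F} -> path (delete_edges G F) u p.
Proof.
elim: p u => //= x p IH u /andP[Gux Gp] H.
rewrite /del_adj Gux H ?inE ?eqxx //=.
by apply: IH => // e ep; apply: H; rewrite inE ep orbT.
Qed.

Lemma delete_edges_sub G F : subrel (delete_edges G F) G.
Proof. by move=> x y /andP[]. Qed.

Lemma path_edges_delete G F u p : path (delete_edges G F) u p ->
  {in path_edges u p, forall e, e \notin F}.
Proof.
elim: p u => //= x p IH u /andP[/andP[_ H] Gp] e.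
by rewrite inE => /predU1P[->//|]; apply: IH.
Qed.

Lemma connect_is_path G u v : connect G u v -> exists p, is_path G u v p.
Proof.
case/connectP=> q; case/shortenP=> p Gp Up _ ->.
by exists p; apply/and3P.
Qed.

Lemma is_path_delete G F u v p : is_path (delete_edges G F) u v p ->
  is_path G u v p.
Proof.
case/and3P=> Gp ? ?; apply/and3P; split=> //.
exact: sub_path (@delete_edges_sub _ _) _ _ Gp.
Qed.

Lemma mem_path_edges x u p e : e \in path_edges u p -> x \in e -> x \in u :: p.
Proof.
elim: p u => //= z p IH u; rewrite inE => /predU1P[->|ep xe].
  by rewrite !inE => /orP[]->; rewrite ?orbT.
by rewrite inE (IH z) // orbT.
Qed.

(** The edge e separates u from v when its deletion leaves no path from u to
    v. *)
Definition separates G e u v := ~~ connect (delete_edges G [set e]) u v.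

Lemma separates_sym G e u v : separates G e u v = separates G e v u.
Proof. by rewrite /separates connect_adj_sym. Qed.

Lemma separates_path G e u p : path G u p -> separates G e u (last u p) ->
  e \in path_edges u p.
Proof.
move=> Gp; apply: contraNT => ep; apply/connectP; exists p => //.
by apply: path_delete => // f fp; rewrite inE; apply: contraNneq ep => <-.
Qed.

Lemma acyclic_bridge G x y : acyclic G -> G x y -> separates G [set x; y] x y.
Proof.
move=> acG Gxy; apply/negP; rewrite connect_adj_sym => /connect_is_path[p ip].
have /and3P[Gp /eqP lp Up] := is_path_delete ip.
case: p => [|z [|z' p]] in ip Gp lp Up *.
- by move: Gxy; rewrite -lp /= adj_irr.
- case/and3P: ip => /= /andP[/andP[_]]; move: lp => /= ->.
  by rewrite inE setUC eqxx.
- apply: (acG [:: y, z, z' & p]) => //; apply/andP; split=> //.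
  by rewrite /cycle rcons_path Gp lp.
Qed.

Lemma bridges_acyclic G :
  (forall x y, G x y -> separates G [set x; y] x y) -> acyclic G.
Proof.
move=> br [|x [|y [|z p]]] // _ /andP[]; rewrite /cycle rcons_path.
move=> /andP[/= /and3P[Gxy Gyz Gzp] Glx] /and4P[xyzp yzp _ _].
have /negP := br x y Gxy; apply; rewrite connect_adj_sym.
(* The rest of the cycle is a detour around its edge xy. *)
apply: (@connect_trans _ _ z).
  apply: connect1; rewrite /= /del_adj Gyz inE; apply/eqP => /set2_inj[][].
    by move=> yx; rewrite yx inE eqxx in xyzp.
  by move=> _ zx; rewrite zx !inE eqxx orbT in xyzp.
apply/connectP; exists (rcons p x); last by rewrite last_rcons.
apply: path_delete; first by rewrite rcons_path Gzp.
move=> e ep; rewrite inE; apply: contraTneq ep => ->; apply/negP.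
move/(mem_path_edges (x := y)); rewrite !inE eqxx orbT mem_rcons => /(_ isT).
rewrite inE orbCA => /predU1P[yx|].
  by rewrite yx inE eqxx in xyzp.
by move=> yzp'; rewrite inE yzp' in yzp.
Qed.

Lemma connected_delete_edge G x y : connected G ->
  ~~ separates G [set x; y] x y -> connected (delete_edges G [set [set x; y]]).
Proof.
move=> cG /negPn cxy; apply/forallP=> u; apply/forallP=> v.
apply: (connect_sub _ (connectedP u v cG)) => a b Gab.
have [/set2_inj[][-> ->]//|ab] := eqVneq [set a; b] [set x; y].
  by rewrite connect_adj_sym.
by apply: connect1; rewrite /= /del_adj Gab inE.
Qed.

Lemma nontree_nonbridge G : connected G -> ~ tree G ->
  exists e, e \in edges G /\ connected (delete_edges G [set e]).
Proof.
move=> cG ntG.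
case: (boolP [forall x, forall y, G x y ==> separates G [set x; y] x y]).
  move=> H; case: ntG; split=> //; apply: bridges_acyclic => x y Gxy.
  by move/forallP/(_ x)/forallP/(_ y)/implyP: H; apply.
case/forallPn=> x /forallPn[y]; rewrite negb_imply => /andP[Gxy nb].
by exists [set x; y]; rewrite mem_edges; split=> //; exact: connected_delete_edge.
Qed.

(** In an acyclic graph the component of x after the deletion of an edge xy
    contains an end vertex: extend a simple path that starts with the edge yx
    for as long as possible. *)
Lemma acyclic_side_end_vertex G x y : acyclic G -> G x y ->
  exists2 l, l \in end_vertices G
           & connect (delete_edges G [set [set x; y]]) x l.
Proof.
move=> acG Gxy.
(* The path is kept in reverse order, v :: a :: q with v its current end, so
   that extending it is a cons; k bounds the number of steps left. *)
suff H k v a q : (#|T| - size q <= k)%N -> path G v (a :: q) ->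
    uniq (v :: a :: q) -> y \in a :: q ->
    connect (delete_edges G [set [set x; y]]) x v ->
    exists2 l, l \in end_vertices G
           & connect (delete_edges G [set [set x; y]]) x l.
  apply: (H #|T| x y [::]) => //=; first by rewrite leq_subr.
  - by rewrite Gxy.
  - by rewrite inE !andbT; apply: contraTneq Gxy => ->; rewrite adj_irr.
  - by rewrite inE.
elim: k v a q => [|k IH] v a q.
  move=> sz _ /card_uniqP /= U.
  by have := max_card (mem [:: v, a & q]); rewrite U; lia.
move=> sz Gq Uq yq cv.
case: (boolP (v \in end_vertices G)) => [|vn]; first by exists v.
have Gva : G v a by case/andP: Gq.
have [z Gvz za] : exists2 z, G v z & z != a.
  apply/exists_inP; apply: contraNT vn; rewrite negb_exists_in => /forall_inP H.
  apply/end_vertexP; exists a => z; apply/idP/eqP => [/H /negPn/eqP //|->//].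
have zv : z != v by apply: contraTneq Gvz => ->; rewrite adj_irr.
case: (boolP (z \in q)) => [zq|znq].
  (* A second neighbour of v on the path would close a cycle. *)
  exfalso; case/splitPr: zq => q1 q2 in sz Gq Uq yq *.
  apply: (acG [:: z, v, a & q1]) => //; apply/andP; split.
    rewrite /cycle /= adj_sym Gvz; move: Gq => /= /andP[->].
    by rewrite cat_path rcons_path /= => /and3P[-> ->].
  move: Uq; rewrite -!cat_cons cat_uniq => /and3P[U1 /hasPn/(_ z) zn _].
  by rewrite cons_uniq U1 andbT zn ?inE ?eqxx.
apply: (IH z v (a :: q)).
- by rewrite /= subnS -ltnS; case: (_ - _)%N sz => [|s]; rewrite ?ltnS.
- by rewrite /= adj_sym Gvz.
- by rewrite cons_uniq Uq !inE !negb_or zv za znq.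
- by rewrite inE yq orbT.
apply: connect_trans cv (connect1 _); rewrite /= /del_adj Gvz inE.
apply/eqP => E; have := set22 x y; rewrite -E !inE => /pred2P[yv|yz].
  by move: Uq; rewrite cons_uniq -yv yq.
by move: yq; rewrite yz inE (negPf za) (negPf znq).
Qed.

(** * Edge counts of a tree and of its complement *)

Lemma tree_end_vertices_separated G e : tree G -> e \in edges G ->
  exists l l', [/\ l \in end_vertices G, l' \in end_vertices G & separates G e l l'].
Proof.
case=> _ acG /edgesP[x [y [-> Gxy]]].
have [l Ll xl] := acyclic_side_end_vertex acG Gxy.
have [] := @acyclic_side_end_vertex _ y x acG; first by rewrite adj_sym.
rewrite [[set y; x]]setUC => l' Ll' yl'; exists l, l'; split=> //.
apply: contraNN (acyclic_bridge acG Gxy) => ll'.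
by apply: connect_trans xl (connect_trans ll' _); rewrite connect_adj_sym.
Qed.

Lemma tree_end_vertex_beyond G e v : tree G -> e \in edges G ->
  exists2 l, l \in end_vertices G & separates G e v l.
Proof.
move=> tG /(tree_end_vertices_separated tG)[l [l' [Ll Ll' ll']]].
case: (boolP (separates G e v l)) => [|/negPn vl]; first by exists l.
exists l' => //; apply: contraNN ll'; apply: connect_trans.
by rewrite connect_adj_sym.
Qed.

(** Deleting an edge of a tree separates r from exactly one of its ends. *)
Lemma tree_edge_orientation G x y r : tree G -> G x y ->
  separates G [set x; y] r x = ~~ separates G [set x; y] r y.
Proof.
case=> cG acG Gxy; set e := [set x; y].
case: (boolP (separates G e r y)) => [sry|/negPn ry] /=; last first.
  apply: contraNN (acyclic_bridge acG Gxy); rewrite connect_adj_sym => xr.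
  exact: connect_trans xr ry.
apply/negbTE/negP=> srx.
(* Some edge leaves the component of r in G - e, and that edge must be e. *)
pose S := [set z | connect (delete_edges G [set e]) r z].
have [||a [b []]] := @connect_cross G S r x (connectedP r x cG).
- by rewrite inE connect0.
- by rewrite inE.
rewrite !inE => ra rb Gab; have [/set2_inj[][? _]|ab] := eqVneq [set a; b] e.
- by subst a; rewrite /separates ra in srx.
- by subst a; rewrite /separates ra in sry.
case/negP: rb; apply: connect_trans ra (connect1 _).
by rewrite /= /del_adj Gab inE.
Qed.

(** Call the end of an edge that is separated from the root r by that edge its
    lower end. A vertex x other than r is the lower end of a unique edge, the
    last one of a simple path from r to x. *)
Lemma tree_parent_edge G r x : tree G -> x != r ->
  exists e0, forall e,
    [&& e \in edges G, x \in e & separates G e r x] = (e == e0).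
Proof.
move=> [cG acG] xr; have [p /and3P[Gp /eqP lp Up]] := connect_is_path (connectedP r x cG).
case/lastP: p => [|p z] in Gp lp Up *; first by rewrite -lp eqxx in xr.
move: lp; rewrite last_rcons => zx; subst z; set y := last r p.
exists [set y; x] => e; apply/and3P/eqP => [[eG xe se]|->].
  have := separates_path (e := e) Gp; rewrite last_rcons => /(_ se).
  rewrite /path_edges -cats1 pairmap_cat mem_cat => /orP[ep|].
    have := mem_path_edges ep xe; move: Up.
    by rewrite -rcons_cons rcons_uniq => /andP[/negPf->].
  by rewrite inE => /eqP.
move: Gp Up; rewrite rcons_path -rcons_cons rcons_uniq => /andP[Gp Gyx] /andP[xp _].
rewrite mem_edges set22; split=> //.
apply: contraNN (acyclic_bridge acG Gyx) => rx; apply: connect_trans rx.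
rewrite connect_adj_sym; apply/connectP; exists p => //.
apply: path_delete => // f fp; rewrite inE; apply: contraNneq xp => fE.
by apply: mem_path_edges fp _; rewrite fE set22.
Qed.

Lemma card_edges_tree G : (0 < #|T|)%N -> tree G -> #|edges G| = #|T|.-1.
Proof.
case/card_gt0P=> r _ tG.
(* Each edge has one lower end, and each vertex but r is one lower end. *)
pose child e x : bool := (x \in e) && separates G e r x.
transitivity (\sum_(e in edges G) \sum_(x : T) child e x)%N.
  rewrite -sum1_card; apply: eq_bigr => e /edgesP[x [y [-> Gxy]]].
  have yx : y != x by apply: contraTneq Gxy => ->; rewrite adj_irr.
  rewrite (bigD1 x) //= (bigD1 y) //= big1 => [|z /andP[zx zy]].
    rewrite /child !inE !eqxx orbT /= (tree_edge_orientation r tG Gxy).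
    by case: separates.
  by rewrite /child !inE (negPf zx) (negPf zy).
rewrite exchange_big (bigD1 r) //= big1 ?add0n => [|e _].
  transitivity (\sum_(x | x != r) 1)%N; last first.
    by rewrite sum1_card; have := cardC1 r; rewrite /predC1 => <-.
  apply: eq_bigr => x xr; have [e0 H] := tree_parent_edge tG xr.
  rewrite -big_mkcondr /= (eq_bigl (pred1 e0)) ?big_pred1_eq //.
by rewrite /child /separates connect0 andbF.
Qed.

Lemma card_edges_complement G :
  (#|edges G| + #|edges (complement G)| = 'C(#|T|, 2))%N.
Proof.
have disj : edges G :&: edges (complement G) = set0.
  apply/setP=> e; rewrite !inE; apply/negP => /andP[/edgesP[x [y [-> Gxy]]]].
  by rewrite mem_edges /= /compl_adj Gxy andbF.
rewrite -cardsUI disj cards0 addn0 -card_draws; apply: eq_card => e.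
rewrite !inE; apply/orP/cards2P => [H|[x [y [xy ->]]]]; last first.
  by rewrite !mem_edges /= /compl_adj xy; case: (G x y); auto.
have [x [y [-> xy]]] : exists x y, e = [set x; y] /\ x != y.
  case: H => /edgesP[x [y [-> Gxy]]]; exists x, y; split=> //.
    by apply: contraTneq Gxy => ->; rewrite adj_irr.
  by case/andP: Gxy.
by exists x, y; rewrite xy.
Qed.

Lemma card_edges_cotree G : (0 < #|T|)%N -> tree G ->
  (#|edges (complement G)| * 2 = #|T|.-1 * (#|T| - 2))%N.
Proof.
move=> T0 tG; have := card_edges_complement G; rewrite (card_edges_tree T0 tG).
have := mul_bin_left #|T| 1; rewrite bin1.
by case: #|T| T0 => // k _ /=; rewrite subn1 /=; nia.
Qed.

Lemma tree_card_end_vertices_gt0 G :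
  (1 < #|T|)%N -> tree G -> (0 < #|end_vertices G|)%N.
Proof.
move=> T1 tG; have /card_gt0P[e eG] : (0 < #|edges G|)%N.
  by rewrite card_edges_tree //; lia.
have [l [_ [Ll _ _]]] := tree_end_vertices_separated tG eG.
by apply/card_gt0P; exists l.
Qed.

Lemma tree_cotree_card G : (1 < #|T|)%N ->
  tree G -> tree (complement G) -> #|T| = 4%N.
Proof.
move=> T1 tG tG'; have T0 := ltnW T1.
by have := card_edges_cotree T0 tG; rewrite card_edges_tree //; nia.
Qed.

(** * Edge-connectivity *)

(** The edges with exactly one end in S: those that meet S without being
    contained in it. *)
Definition edge_boundary G S : {set {set T}} :=
  [set e in edges G | (e :&: S != set0) && ~~ (e \subset S)].

Lemma mem_edge_boundary G S x y : G x y ->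
  ([set x; y] \in edge_boundary G S) = (x \in S) (+) (y \in S).
Proof.
move=> Gxy; rewrite inE mem_edges Gxy subUset !sub1set /=.
case: (boolP (x \in S)) => xS; case: (boolP (y \in S)) => yS; rewrite ?andbF //= andbT.
- by apply/set0Pn; exists x; rewrite !inE eqxx.
- by apply/set0Pn; exists y; rewrite !inE eqxx orbT.
apply/negbTE; rewrite negbK; apply/eqP/setP => z; rewrite !inE.
by apply/negP => /andP[/pred2P[->|->]]; apply/negP.
Qed.

Lemma edge_connectivity_le_boundary G S u v : u \in S -> v \notin S ->
  (edge_connectivity G <= #|edge_boundary G S|)%N.
Proof.
move=> uS vS; have T1 : (1 < #|T|)%N.
  by apply/card_gt1P; exists u, v; split=> //; apply: contraNneq vS => <-.
have [_] := edge_connectivity_min G T1; apply; apply/andP; split.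
  by apply/subsetP=> e; rewrite inE => /andP[].
apply/negP=> /(connectedP u v)/connect_cross-/(_ S uS vS)[x [y [xS yS]]].
case/andP=> Gxy; rewrite mem_edge_boundary // xS.
by rewrite (negPf yS).
Qed.

Lemma edge_connectivity_gt0 G : (1 < #|T|)%N -> connected G ->
  (0 < edge_connectivity G)%N.
Proof.
move=> T1 cG; have [[F /andP[_ dF] <-] _] := edge_connectivity_min G T1.
rewrite card_gt0; apply: contraNneq dF => ->; apply/forallP=> u; apply/forallP=> v.
apply: (connect_sub _ (connectedP u v cG)) => x y Gxy; apply: connect1.
by rewrite /= /del_adj Gxy inE.
Qed.

Lemma edge_connectivity_pendant G c z :
  connected G -> (forall y, G c y = (y == z)) -> edge_connectivity G = 1%N.
Proof.
move=> cG Gc; have Gcz : G c z by rewrite Gc.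
have zc : z != c by apply: contraTneq Gcz => ->; rewrite adj_irr.
have T1 : (1 < #|T|)%N by apply/card_gt1P; exists z, c.
apply/eqP; rewrite eqn_leq edge_connectivity_gt0 // andbT.
apply: leq_trans (@edge_connectivity_le_boundary G [set c] c z _ _) _; rewrite ?inE //.
apply: leq_trans (_ : #|[set [set c; z]]| <= 1)%N; last by rewrite cards1.
apply/subset_leq_card/subsetP => e eB; have : e \in edges G by move: eB; rewrite inE => /andP[].
case/edgesP=> x [y [eE Gxy]]; move: eB; rewrite eE mem_edge_boundary // !inE.
case: eqP => [xc _|_ /= /eqP yc]; move: Gxy.
  by rewrite xc Gc => /eqP->.
by rewrite yc adj_sym Gc => /eqP->; rewrite setUC.
Qed.

Lemma connected_neighbour G x y : connected G -> y != x -> exists2 z, G x z & z != x.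
Proof.
move=> cG yx; have [||a [b []]] := @connect_cross G [set x] x y (connectedP x y cG).
- by rewrite inE.
- by rewrite inE.
by rewrite !inE => /eqP-> bx Gxb; exists b.
Qed.

(** * Number of end vertices *)

Lemma exists_neq x : (1 < #|T|)%N -> exists y, y != x.
Proof.
case/card_gt1P=> a [b [_ _ ab]]; have [ax|] := eqVneq a x; last by exists a.
by exists b; rewrite -ax eq_sym.
Qed.

Lemma nondominated_of_complement G x : (1 < #|T|)%N ->
  connected (complement G) -> exists2 y, y != x & ~~ G x y.
Proof.
move=> T1 cG'; have [y yx] := exists_neq x T1.
by have [z /andP[_ nGxz] zx] := connected_neighbour cG' yx; exists z.
Qed.

Lemma complement_nondominated G x :
  (1 < #|T|)%N -> connected G -> exists2 y, y != x & ~~ complement G x y.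
Proof.
move=> T1 cG; have [y yx] := exists_neq x T1.
have [z Gxz zx] := connected_neighbour cG yx; exists z => //.
by rewrite /= /compl_adj Gxz andbF.
Qed.

Lemma end_vertex_neighbour G a b : connected G -> (2 < #|T|)%N ->
  a \in end_vertices G -> G a b -> b \notin end_vertices G.
Proof.
move=> cG T3 /end_vertexP[b' Ha] Gab; apply/negP => /end_vertexP[a' Hb].
have bE : b' = b by apply/eqP; rewrite eq_sym -Ha.
have aE : a' = a by apply/eqP; rewrite eq_sym -Hb adj_sym.
have [v vab] : exists v, v \notin [set a; b].
  apply/existsP; apply: contraTT T3 => /existsPn H; rewrite -leqNgt.
  apply: leq_trans (_ : #|[set a; b]| <= 2)%N; last by rewrite cards2; case: eqP.
  by apply/subset_leq_card/subsetP => z _; have := H z; rewrite negbK.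
have [||x [y []]] := @connect_cross G [set a; b] a v (connectedP a v cG) => //.
  by rewrite set21.
rewrite !inE => /pred2P[]-> /norP[ya yb].
  by rewrite Ha bE (negPf yb).
by rewrite Hb aE (negPf ya).
Qed.

(** Only a vertex adjacent to all the others, as in a star, can leave fewer
    than two vertices that are not end vertices. *)
Lemma card_end_vertices_le G : connected G -> (2 < #|T|)%N ->
  (forall x, exists2 y, y != x & ~~ G x y) -> (#|end_vertices G| <= #|T| - 2)%N.
Proof.
move=> cG T3 nd; set L := end_vertices G.
have nbr x : exists2 z, G x z & z != x.
  by have [y yx _] := nd x; apply: connected_neighbour cG yx.
have [b Lb] : exists b, b \notin L.
  have /card_gt0P[a _] : (0 < #|T|)%N by lia.
  case: (boolP (a \in L)) => [La|]; last by exists a.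
  have [b Gab _] := nbr a; exists b; exact: end_vertex_neighbour La Gab.
have [c Lc cb] : exists2 c, c \notin L & c != b.
  have [d db Gbd] := nd b; case: (boolP (d \in L)) => [Ld|]; last by exists d.
  have [c Gdc _] := nbr d; exists c; first exact: end_vertex_neighbour Ld Gdc.
  by apply: contraNneq Gbd => <-; rewrite adj_sym.
have : (#|[set b; c]| <= #|~: L|)%N.
  by apply/subset_leq_card/subsetP => z; rewrite in_set2 in_setC => /pred2P[]->.
by have := cardsC L; rewrite cards2 eq_sym cb; lia.
Qed.

(** * The path on four vertices and the broom *)

(** The vertices a, b, c, d are distinct and induce the path a - b - c - d. *)
Definition induced_path4 G a b c d : Prop :=
  [/\ uniq [:: a; b; c; d], [/\ G a b, G b c & G c d]
    & [/\ ~~ G a c, ~~ G a d & ~~ G b d]].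

Lemma induced_path4_complement G a b c d :
  induced_path4 G a b c d -> induced_path4 (complement G) c a d b.
Proof.
move=> [+ [ab bc cd] [ac ad bd]]; rewrite /= !inE !negb_or.
case/and4P=> /and3P[Eab Eac Ead] /andP[Ebc Ebd] Ecd _.
rewrite /induced_path4 /= /compl_adj !inE !negb_or !negb_and !negbK.
rewrite [c == a]eq_sym [c == b]eq_sym [d == b]eq_sym Eab Eac Ead Ebc Ebd Ecd /=.
by rewrite ![G c _]adj_sym [G d b]adj_sym ac ad bd ab bc [G d c]adj_sym cd !orbT.
Qed.

(** From an end vertex a with neighbour b, continue with another neighbour c
    of b, and let d be a vertex not adjacent to b. *)
Lemma exists_induced_path4 G : #|T| = 4%N -> connected G ->
  connected (complement G) -> (exists a, a \in end_vertices G) ->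
  exists a b c d, induced_path4 G a b c d.
Proof.
move=> T4 cG cG' [a La]; have [b Ha] := end_vertexP _ _ La.
have Gab : G a b by rewrite Ha.
have ba : b != a by apply: contraTneq Gab => ->; rewrite adj_irr.
have Lb : b \notin end_vertices G by apply: end_vertex_neighbour La Gab => //; rewrite T4.
have [c Gbc ca] : exists2 c, G b c & c != a.
  apply/exists_inP; apply: contraNT Lb; rewrite negb_exists_in => /forall_inP H.
  apply/end_vertexP; exists a => z; apply/idP/eqP => [/H /negPn/eqP //|->].
  by rewrite adj_sym.
have ab : a != b by rewrite eq_sym.
have [d /andP[bd nGbd] _] := connected_neighbour cG' ab.
have da : d != a by apply: contraNneq nGbd => ->; rewrite adj_sym.
have dc : d != c by apply: contraNneq nGbd => ->.
have U : uniq [:: a; b; c; d].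
  by rewrite /= !inE !negb_or [a == b]eq_sym ba [a == c]eq_sym ca [a == d]eq_sym da
    bd [c == d]eq_sym dc !andbT /=; apply: contraTneq Gbc => ->; rewrite adj_irr.
have mem_abcd z : z \in [:: a; b; c; d].
  have /subset_cardP : #|[:: a; b; c; d]| = #|T| by rewrite (card_uniqP U) T4.
  by move/(_ (subset_predT _))->.
exists a, b, c, d; split=> //.
  have ad : a != d by rewrite eq_sym.
  split=> //; have [z Gdz zd] := connected_neighbour cG ad.
  move: Gdz (mem_abcd z); rewrite !inE (negPf zd) orbF.
  move=> + /or3P[]/eqP zE; rewrite zE adj_sym // => Gzd.
    by move: Gzd; rewrite Ha eq_sym => /eqP bd'; rewrite bd' eqxx in bd.
  by rewrite Gzd in nGbd.
rewrite !Ha; split=> //.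
  by apply: contraTneq Gbc => ->; rewrite adj_irr.
by rewrite eq_sym.
Qed.

Lemma induced_path4_isomorphic G a b c d : #|T| = 4%N ->
  induced_path4 G a b c d -> isomorphic G (path_graph 4).
Proof.
move=> T4 [U [ab bc cd] [ac ad bd]].
pose g (i : 'I_4) := nth a [:: a; b; c; d] i.
have g_inj : injective g.
  by move=> i j /eqP; rewrite nth_uniq // => /eqP/val_inj.
have [f gK fK] : bijective g by apply: inj_card_bij => //; rewrite T4 card_ord.
exists f; split; first by exists g.
move=> x y; rewrite -{2}[x]fK -{2}[y]fK; move: (f x) (f y) => {x y} i j.
case: i => [[|[|[|[|//]]]] ?]; case: j => [[|[|[|[|//]]]] ?];
  rewrite /g /path_graph /sym_closure /path_arc /= ?adj_irr //;
  rewrite ?ab ?bc ?cd ?(negPf ac) ?(negPf ad) ?(negPf bd) //;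
  by rewrite adj_sym ?ab ?bc ?cd ?(negPf ac) ?(negPf ad) ?(negPf bd).
Qed.

(** The centre of the broom, vertex 2, is adjacent to all vertices but the far
    end 0 of the path, so it is an end vertex of the complement. *)
Lemma broom_complement_pendant G k :
  isomorphic G (broom 3 k) ->
  exists c z, forall y, complement G c y = (y == z).
Proof.
case=> f [[g gK fK] fG].
pose i0 : 'I_(3 + k) := lshift k ord0; pose i2 : 'I_(3 + k) := lshift k ord_max.
exists (g i2), (g i0) => y; rewrite /= /compl_adj -fG fK.
rewrite [g i2 == y]eq_sym -!(can2_eq gK fK) -!val_eqE /=.
rewrite /sym_closure /broom_arc /=.
by case: (f y) => [[|[|[|j]]] lj] /=; rewrite ?ltnS ?leq0n ?orbT.
Qed.

End Combinatorics.

(** * Weighted distance and eccentricity *)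

Section WeightedDistance.
Variables (R : realType) (T : finType).
Implicit Types (G : sgraph T) (e : {set T}) (w : {set T} -> R) (phi : T -> R).
Implicit Types (u v x y : T) (c : R).

Lemma path_weight_separates G w u p : normalised G w ->
  path G u p -> uniq (u :: p) ->
  \sum_(e in edges G | separates G e u (last u p)) w e <= path_weight w u p.
Proof.
move=> [w0 _] Gp Up; rewrite /path_weight big_uniq ?path_edges_uniq //=.
rewrite [leRHS](bigID (fun e => separates G e u (last u p))) /=.
rewrite [X in X + _](eq_bigl (fun e => (e \in edges G) && separates G e u (last u p))).
  by rewrite lerDl sumr_ge0 // => e /andP[/(path_edges_sub Gp)/w0].
move=> e /=; case: (boolP (separates _ _ _ _)) => [se|]; rewrite ?andbF ?andbT //.
have ep := separates_path Gp se.
by rewrite ep (path_edges_sub Gp ep).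
Qed.

Lemma wdist_separates G w u v : normalised G w -> connected G ->
  \sum_(e in edges G | separates G e u v) w e <= wdist G w u v.
Proof.
move=> nw cG; have [[p /and3P[Gp /eqP lp Up] <-] _] := wdist_min u v nw cG.
by rewrite -{1}lp; apply: path_weight_separates.
Qed.

Lemma wdistxx G w u : normalised G w -> connected G -> wdist G w u u <= 0.
Proof.
move=> nw cG; have [_ /(_ [::])] := wdist_min u u nw cG.
by rewrite /path_weight big_nil; apply; apply/and3P.
Qed.

Lemma wdist_le_size G w u v : normalised G w -> connected G ->
  wdist G w u v <= #|edges G|%:R.
Proof.
move=> nw cG; have [[p ip <-] _] := wdist_min u v nw cG.
by rewrite -(proj2 nw); apply: path_weight_le nw ip.
Qed.

Lemma wdist_step G w u x y : normalised G w -> connected G -> G x y ->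
  wdist G w u y <= wdist G w u x + w [set x; y].
Proof.
move=> nw cG Gxy; have [[p /and3P[Gp /eqP lp Up] <-] _] := wdist_min u x nw cG.
have [_ wmin] := wdist_min u y nw cG.
have wxy : 0 <= w [set x; y] by apply: (proj1 nw); rewrite mem_edges.
case: (boolP (y \in u :: p)) => yp; last first.
  have ip : is_path G u y (rcons p y).
    apply/and3P; split; last by rewrite -rcons_cons rcons_uniq yp.
      by rewrite rcons_path Gp lp.
    by rewrite last_rcons.
  apply: le_trans (wmin _ ip) _; rewrite /path_weight /path_edges -cats1.
  by rewrite pairmap_cat big_cat big_cons big_nil /= lp addr0.
case/splitPl: yp Gp lp Up => p1 p2 l1 Gp lp Up.
have ip : is_path G u y p1.
  move: Gp Up; rewrite cat_path -cat_cons cat_uniq => /andP[Gp1 _] /and3P[U1 _ _].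
  by apply/and3P; split=> //; apply/eqP.
apply: le_trans (wmin _ ip) _; rewrite /path_weight /path_edges pairmap_cat big_cat /=.
rewrite -addrA lerDl addr_ge0 // big_seq sumr_ge0 // => e.
move: Gp; rewrite cat_path => /andP[_ /path_edges_sub sub] /sub.
exact: (proj1 nw).
Qed.

Lemma wdist_le_wecc G w u v : wdist G w u v <= wecc G w v.
Proof. exact: (le_bigmax _ (fun u => wdist G w u v)). Qed.

Lemma wecc_le G w v c : 0 <= c -> (forall u, wdist G w u v <= c) -> wecc G w v <= c.
Proof. by move=> c0 H; apply: bigmax_le. Qed.

Lemma wecc_ge0 G w v : 0 <= wecc G w v.
Proof. exact: bigmax_ge_id. Qed.

Lemma avec_ge0 G w : 0 <= avec G w.
Proof. by rewrite mulr_ge0 ?invr_ge0 ?ler0n // sumr_ge0 // => v _; apply: wecc_ge0. Qed.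

Lemma avec_le G w c : (0 < #|T|)%N -> (forall v, wecc G w v <= c) -> avec G w <= c.
Proof.
move=> T0 H; rewrite /avec ler_pdivrMl ?ltr0n // mulr_natl.
by have <- : \sum_(v : T) c = c *+ #|T|; [rewrite sumr_const | exact: ler_sum].
Qed.

Lemma avec_ge G w c : (0 < #|T|)%N -> (forall v, c <= wecc G w v) -> c <= avec G w.
Proof.
move=> T0 H; rewrite /avec ler_pdivlMl ?ltr0n // mulr_natl.
by have <- : \sum_(v : T) c = c *+ #|T|; [rewrite sumr_const | exact: ler_sum].
Qed.

(** * The edge-connectivity bound *)

(** If phi changes by at most w e along every edge e, then its oscillation is
    at most the total weight divided by the edge-connectivity: a discrete
    coarea inequality. *)
Lemma edge_connectivity_gap G w phi u v :
  (forall e, e \in edges G -> 0 <= w e) ->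
  (forall x y, G x y -> phi y - phi x <= w [set x; y]) ->
  (edge_connectivity G)%:R * (phi v - phi u) <= \sum_(e in edges G) w e.
Proof.
move=> w0 lip.
(* r x is the rank of x in the order of increasing phi, and g the sequence of
   the sorted values; the default u of nth is never reached. *)
pose s := sort (fun x y => phi x <= phi y) (enum T).
pose r x := index x s; pose g i := phi (nth u s i).
have ss : size s = #|T| by rewrite size_sort cardE.
have Us : uniq s by rewrite sort_uniq enum_uniq.
have ms x : x \in s by rewrite mem_sort mem_enum.
have gr x : g (r x) = phi x by rewrite /g nth_index.
have rlt x : (r x < #|T|)%N by rewrite -ss index_mem.
have g_mono i j : (j < #|T|)%N -> (i <= j)%N -> g i <= g j.
  move=> jT ij.
  apply: (sorted_leq_nth (leT := fun x y => phi x <= phi y)) => //.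
  - by move=> y x z; apply: le_trans.
  - by apply: sort_sorted => x y; apply: le_total.
  - by rewrite inE ss (leq_ltn_trans ij).
  - by rewrite inE ss.
have T0 : (0 < #|T|)%N by apply/card_gt0P; exists u.
pose N := #|T|.-1; have NT k : (k < N)%N = (k.+1 < #|T|)%N by rewrite /N; lia.
pose S k := [set x | (r x <= k)%N].
pose gap k := g k.+1 - g k.
have gap0 k : (k < N)%N -> 0 <= gap k.
  by rewrite NT => kT; rewrite subr_ge0 g_mono.
have cutS k : (k < N)%N -> (edge_connectivity G <= #|edge_boundary G (S k)|)%N.
  rewrite NT => kT; apply: (@edge_connectivity_le_boundary _ _ _ (nth u s 0) (nth u s k.+1)).
    by rewrite inE /r index_uniq // ss.
  by rewrite inE /r index_uniq ?ss // ltnn.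
apply: (@le_trans _ _ ((edge_connectivity G)%:R * (g N - g 0%N))).
  rewrite ler_wpM2l // lerB // -gr g_mono //; first by rewrite /N; lia.
  by rewrite /N; have := rlt v; lia.
rewrite -(telescope_sumr _ (leq0n N)) mulr_sumr.
apply: (@le_trans _ _ (\sum_(0 <= k < N) \sum_(e in edges G)
    (if e \in edge_boundary G (S k) then gap k else 0))).
  rewrite !big_nat; apply: ler_sum => k /andP[_ kN].
  rewrite -big_mkcondr /= (eq_bigl (mem (edge_boundary G (S k)))); last first.
    by move=> e /=; apply: andb_idl; rewrite inE => /andP[].
  by rewrite sumr_const -[leRHS]mulr_natl ler_wpM2r ?gap0 // ler_nat cutS.
rewrite exchange_big; apply: ler_sum => e /edgesP[x [y [-> Gxy]]] /=.
(* An edge lies in the boundary of S k exactly when k is between the ranks of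
   its ends, so the gaps it collects telescope. *)
wlog rxy : x y Gxy / (r x <= r y)%N.
  move=> H; case: (leqP (r x) (r y)) => [|/ltnW] rxy; first exact: H.
  by rewrite [[set x; y]]setUC; apply: H => //; rewrite adj_sym.
apply: le_trans (lip x y Gxy); rewrite -!gr -(telescope_sumr _ rxy).
rewrite [leRHS](big_nat_widenl _ 0) // [leRHS](big_nat_widen _ _ N) //; last first.
  by rewrite /N; have := rlt y; lia.
rewrite -big_mkcond /= le_eqVlt; apply/orP; left; apply/eqP/eq_bigl => k.
by rewrite mem_edge_boundary // !inE; case: leqP; case: leqP => //=; lia.
Qed.

Lemma edge_connectivity_wdist G w u v : normalised G w -> connected G ->
  (edge_connectivity G)%:R * wdist G w u v <= #|edges G|%:R.
Proof.
move=> nw cG; rewrite -(proj2 nw).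
apply: le_trans (_ : (edge_connectivity G)%:R * (wdist G w u v - wdist G w u u) <= _).
  by rewrite ler_wpM2l // lerBrDr -lerBrDl subrr wdistxx.
apply: edge_connectivity_gap (proj1 nw) _ => x y Gxy.
by rewrite lerBlDl wdist_step.
Qed.

Lemma avec_le_edge_connectivity G w : (1 < #|T|)%N -> normalised G w -> connected G ->
  avec G w <= #|edges G|%:R / (edge_connectivity G)%:R.
Proof.
move=> T1 nw cG; have l0 := edge_connectivity_gt0 T1 cG.
apply: avec_le => [|v]; first exact: ltnW.
apply: wecc_le => [|u]; first by rewrite divr_ge0.
by rewrite ler_pdivlMr ?ltr0n // mulrC edge_connectivity_wdist.
Qed.

Lemma avec_le_size G w : (0 < #|T|)%N -> normalised G w -> connected G ->
  avec G w <= #|edges G|%:R.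
Proof.
move=> T0 nw cG; apply: avec_le => // v; apply: wecc_le => // u.
exact: wdist_le_size.
Qed.

(** * The lower bound for trees *)

(** An edge that separates some pair of L separates at least #|L| - 1 pairs,
    each of them counted twice here. *)
Lemma sum_separates_ge G e (L : {set T}) l0 l1 :
  l0 \in L -> l1 \in L -> separates G e l0 l1 ->
  (2 * #|L|.-1 <= \sum_(l in L) \sum_(l' in L) separates G e l l')%N.
Proof.
move=> L0 L1 s01.
(* Every vertex is separated from l0 or from l1. *)
have s2 l : (0 < separates G e l0 l + separates G e l1 l)%N.
  apply: contraTT s01; rewrite -leqNgt leqn0 addn_eq0 !eqb0 !negbK => /andP[a b].
  by apply: connect_trans a _; rewrite connect_adj_sym.
have row l : (0 < \sum_(l' in L) separates G e l l')%N.
  have := s2 l; rewrite ![separates _ _ _ l]separates_sym addn_gt0 => /orP[]H.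
    by rewrite (bigD1 l0) //= addn_gt0 H.
  by rewrite (bigD1 l1) //= addn_gt0 H.
have l10 : l1 != l0 by apply: contraNneq s01 => ->; rewrite connect0.
pose f l := (\sum_(l' in L) separates G e l l')%N.
have f01 : (#|L| <= f l0 + f l1)%N by rewrite -big_split -sum1_card leq_sum.
have split2 (h : T -> nat) : (\sum_(l in L) h l =
    h l0 + h l1 + \sum_(l in L | (l != l0) && (l != l1)) h l)%N.
  rewrite (bigD1 l0) //= (bigD1 l1) ?L1 //= addnA; congr addn.
  by apply: eq_bigl => l; rewrite andbA.
have card : (#|L| = 2 + \sum_(l in L | (l != l0) && (l != l1)) 1)%N.
  by rewrite -sum1_card split2.
have frest : (\sum_(l in L | (l != l0) && (l != l1)) 1 <=
    \sum_(l in L | (l != l0) && (l != l1)) f l)%N.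
  by apply: leq_sum => l _; apply: row.
rewrite (split2 f); apply: leq_trans (leq_add f01 frest).
by rewrite card; lia.
Qed.

Lemma tree_wecc_ge G w v : normalised G w -> tree G ->
  #|edges G|%:R <= #|end_vertices G|%:R * wecc G w v.
Proof.
move=> nw tG; have [cG _] := tG; set L := end_vertices G.
apply: le_trans (_ : \sum_(l in L) wdist G w l v <= _); last first.
  by rewrite mulr_natl -sumr_const ler_sum // => l _; apply: wdist_le_wecc.
apply: le_trans (_ : \sum_(l in L) \sum_(e in edges G | separates G e l v) w e <= _);
  last by apply: ler_sum => l _; apply: wdist_separates.
rewrite -(proj2 nw).
under [leRHS]eq_bigr => l _ do rewrite big_mkcondr /=.
rewrite exchange_big; apply: ler_sum => e eG /=.
have [l Ll sl] := tree_end_vertex_beyond v tG eG.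
rewrite (bigD1 l) //= [separates _ _ l v]separates_sym sl lerDl sumr_ge0 // => l' _.
by case: ifP => // _; apply: (proj1 nw).
Qed.

Lemma tree_sum_wecc_end_vertices G w : normalised G w -> tree G -> (1 < #|T|)%N ->
  2 * #|edges G|%:R <= \sum_(l in end_vertices G) wecc G w l.
Proof.
move=> nw tG T1; have [cG _] := tG; set L := end_vertices G.
have L1 : (1 < #|L|)%N.
  have /card_gt0P[e eG] : (0 < #|edges G|)%N by rewrite card_edges_tree //; lia.
  have [l [l' [Ll Ll' s]]] := tree_end_vertices_separated tG eG.
  apply/card_gt1P; exists l, l'; split=> //.
  by apply: contraNneq s => ->; rewrite connect0.
have k0 : 0 < #|L|.-1%:R :> R by rewrite ltr0n; lia.
(* Each end vertex l is compared with the k - 1 others. *)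
rewrite -(ler_pM2l k0).
apply: le_trans (_ : \sum_(l in L) \sum_(l' in L) wdist G w l' l <= _); last first.
  rewrite mulr_sumr ler_sum // => l Ll; rewrite (bigD1 l) //=.
  apply: le_trans (_ : 0 + \sum_(l' in L | l' != l) wecc G w l <= _).
    rewrite lerD ?wdistxx // ler_sum // => l' _; exact: wdist_le_wecc.
  rewrite add0r mulr_natl (eq_bigl (mem (L :\ l))) => [|l']; last by rewrite !inE andbC.
  by rewrite sumr_const; have := cardsD1 l L; rewrite Ll => ->.
apply: le_trans (_ : \sum_(l in L) \sum_(l' in L)
    \sum_(e in edges G | separates G e l' l) w e <= _); last first.
  by do 2!apply: ler_sum => ? _; apply: wdist_separates.
have -> : \sum_(l in L) \sum_(l' in L) \sum_(e in edges G | separates G e l' l) w e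
    = \sum_(e in edges G) w e * (\sum_(l in L) \sum_(l' in L) separates G e l' l)%:R.
  rewrite exchange_big /=.
  under eq_bigr => l _ do under eq_bigr => l' _ do rewrite big_mkcondr /=.
  under eq_bigr => l _ do rewrite exchange_big /=.
  rewrite exchange_big /=; apply: eq_bigr => e _.
  rewrite exchange_big natr_sum mulr_sumr; apply: eq_bigr => l _.
  rewrite natr_sum mulr_sumr; apply: eq_bigr => l' _.
  by case: separates; rewrite ?mulr1 ?mulr0.
rewrite -(proj2 nw) mulrA mulrC mulr_suml; apply: ler_sum => e eG.
rewrite ler_wpM2l ?(proj1 nw) // mulrC -natrM ler_nat.
have [l [l' [Ll Ll' s]]] := tree_end_vertices_separated tG eG.
by rewrite exchange_big; apply: sum_separates_ge s.
Qed.

Lemma tree_avec_ge G w (N := #|T|%:R : R) : normalised G w -> tree G ->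
  (2 < #|T|)%N -> (#|end_vertices G| <= #|T| - 2)%N ->
  2 * (N - 1) ^+ 2 / (N * (N - 2)) <= avec G w.
Proof.
move=> nw tG T3; set L := end_vertices G => kn.
have T0 : (0 < #|T|)%N by lia.
have NE : #|edges G|%:R = N - 1 by rewrite card_edges_tree // -subn1 natrB.
have hL := tree_sum_wecc_end_vertices nw tG (ltnW T3).
set SL := \sum_(l in _) _ in hL; pose SN := \sum_(v in ~: L) wecc G w v.
have hN : #|~: L|%:R * (N - 1) <= #|L|%:R * SN.
  rewrite mulr_sumr -NE mulr_natl -sumr_const.
  by apply: ler_sum => v _; apply: tree_wecc_ge.
have sumE : \sum_v wecc G w v = SL + SN.
  by rewrite (bigID (mem L)) /=; congr +%R; apply: eq_bigl => v; rewrite in_setC.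
have cL : N = #|L|%:R + #|~: L|%:R by rewrite -natrD cardsC.
have N3 : 3 <= N by rewrite ler_nat.
have kN : #|L|%:R <= N - 2 by rewrite -natrB ?ler_nat //; lia.
have k0 : 0 < #|L|%:R :> R.
  rewrite ltr0n lt0n; apply: contraTneq hN => k0.
  by rewrite cL k0 mul0r add0r -ltNge in N3 *; nra.
rewrite /avec sumE -/N ler_pdivrMr; last by nra.
have -> : N^-1 * (SL + SN) * (N * (N - 2)) = (SL + SN) * (N - 2).
  by field; lra.
have SN0 : 0 <= SN by apply: sumr_ge0 => v _; apply: wecc_ge0.
have SN2 : 2 * (N - 1) <= SN * (N - 2).
  apply: (@le_trans _ _ (#|L|%:R * SN)); last by rewrite mulrC ler_wpM2l.
  by apply: le_trans hN; rewrite ler_wpM2r //; lra.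
by rewrite NE in hL; nra.
Qed.

Lemma tree_avec_ge_nondominated G w (N := #|T|%:R : R) : (2 < #|T|)%N -> tree G ->
  (forall x, exists2 y, y != x & ~~ G x y) -> normalised G w ->
  2 * (N - 1) ^+ 2 / (N * (N - 2)) <= avec G w.
Proof.
move=> T3 tG nd nw; apply: tree_avec_ge => //.
by apply: card_end_vertices_le => //; case: tG.
Qed.

(** * Extremal weights *)

(** The weight function with all the weight on the edge e. *)

Definition concentrated G e : {set T} -> R :=
  fun f => if f == e then #|edges G|%:R else 0.

Lemma concentrated_normalised G e : e \in edges G -> normalised G (concentrated G e).
Proof.
move=> eG; split=> [f _|]; first by rewrite /concentrated; case: ifP.
rewrite (bigD1 e) //= big1 ?addr0 /concentrated ?eqxx // => f /andP[_ /negPf->] //.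
Qed.

Lemma avec_nonbridge G e : (0 < #|T|)%N -> connected G -> e \in edges G ->
  connected (delete_edges G [set e]) -> avec G (concentrated G e) <= 0.
Proof.
move=> T0 cG eG cGe; apply: avec_le => // v; apply: wecc_le => // u.
have [p ip] := connect_is_path (connectedP u v cGe).
have [_ /(_ p)] := wdist_min u v (concentrated_normalised eG) cG.
move=> /(_ (is_path_delete ip)); rewrite /path_weight big1_seq // => f /andP[_ fp].
case/and3P: ip => /path_edges_delete/(_ f fp); rewrite inE /concentrated.
by move/negPf->.
Qed.

(** Every vertex other than a is separated from a by the pendant edge az. *)
Lemma avec_pendant G a z : connected G -> (forall y, G a y = (y == z)) ->
  #|edges G|%:R <= avec G (concentrated G [set a; z]).
Proof.
move=> cG Gc; have Gcz : G a z by rewrite Gc.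
have zc : z != a by apply: contraTneq Gcz => ->; rewrite adj_irr.
have sepc v : v != a -> separates G [set a; z] a v.
  move=> vc; apply/negP=> /(@connect_cross _ _ [set a])[||x [y []]]; rewrite ?inE //.
  move=> /eqP-> _ /andP[+]; rewrite Gc => /eqP->.
  by rewrite inE eqxx.
have nw : normalised G (concentrated G [set a; z]).
  by apply: concentrated_normalised; rewrite mem_edges.
have dist u v : separates G [set a; z] u v ->
    #|edges G|%:R <= wdist G (concentrated G [set a; z]) u v.
  move=> s; apply: le_trans (wdist_separates u v nw cG).
  rewrite (bigD1 [set a; z]) ?mem_edges ?Gcz ?s //= /concentrated eqxx lerDl.
  by rewrite sumr_ge0 // => e _; case: ifP.
apply: avec_ge => [|v]; first by apply/card_gt0P; exists a.
have [->|vc] := eqVneq v a.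
  apply: le_trans (wdist_le_wecc _ _ z a); apply: dist.
  by rewrite separates_sym sepc.
by apply: le_trans (wdist_le_wecc _ _ a v); apply: dist; rewrite sepc.
Qed.

(** The total weight spread equally over the end vertices: each edge receives
    one share for each of its ends that is an end vertex. *)
Definition end_weight G : {set T} -> R :=
  fun e => #|edges G|%:R / #|end_vertices G|%:R * #|e :&: end_vertices G|%:R.

Lemma end_weight_edge G x y : x != y ->
  end_weight G [set x; y] = #|edges G|%:R / #|end_vertices G|%:R *
    ((x \in end_vertices G)%:R + (y \in end_vertices G)%:R).
Proof.
move=> xy; rewrite /end_weight; congr (_ * _); rewrite -natrD; congr _%:R.
rewrite -sum1_card (eq_bigl _ _ (fun v => in_setI v _ _)).
rewrite big_mkcondr big_setU1 ?in_set1 //=.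
by rewrite big_set1; case: (x \in end_vertices G); case: (y \in end_vertices G).
Qed.

Lemma end_weight_normalised G : (0 < #|end_vertices G|)%N ->
  normalised G (end_weight G).
Proof.
move=> L0; split=> [e _|]; first by rewrite mulr_ge0 ?divr_ge0.
rewrite -mulr_sumr -natr_sum.
suff -> : (\sum_(e in edges G) #|e :&: end_vertices G| = #|end_vertices G|)%N.
  by rewrite divfK // pnatr_eq0 -lt0n.
under eq_bigr => e _.
  rewrite -sum1_card setIC (eq_bigl _ _ (fun v => in_setI v _ _)) big_mkcondr.
  over.
rewrite exchange_big -sum1_card; apply: eq_bigr => l /end_vertexP[b Hl].
have Glb : G l b by rewrite Hl.
rewrite -big_mkcondr (big_pred1 [set l; b]) // => e /=.
apply/andP/eqP => [[/edgesP[x [y [-> Gxy]]]]|->]; last by rewrite mem_edges set21.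
rewrite !inE => /pred2P[] lE; subst l; move: Gxy; last rewrite adj_sym.
  by rewrite Hl => /eqP->.
by rewrite Hl setUC => /eqP->.
Qed.

Lemma end_vertexN_path G x u y : G u x -> G x y -> u != y -> x \notin end_vertices G.
Proof.
move=> Gux Gxy uy; apply/negP=> /end_vertexP[b Hx].
by move: Gux Gxy; rewrite adj_sym !Hx => /eqP ub /eqP yb; rewrite yb ub eqxx in uy.
Qed.

(** The inner vertices of a simple path are not end vertices. *)
Lemma end_weight_path G u p : path G u p -> uniq (u :: p) ->
  path_weight (end_weight G) u p <= #|edges G|%:R / #|end_vertices G|%:R *
    ((u \in end_vertices G)%:R + (last u p \in end_vertices G)%:R).
Proof.
elim: p u => [|x p IH] u Gp Up.
  by rewrite /path_weight big_nil mulr_ge0 ?divr_ge0 ?addr_ge0.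
have ux : u != x by move: Up; rewrite /= inE negb_or => /andP[/andP[]].
rewrite /path_weight /= big_cons end_weight_edge //.
case: p => [|y p] in IH Gp Up *; first by rewrite big_nil addr0.
have xL : x \notin end_vertices G.
  case/and3P: Gp => Gux Gxy _; apply: end_vertexN_path Gux Gxy _.
  by move: Up; rewrite /= !inE !negb_or => /andP[/and3P[_ -> _]].
rewrite (negPf xL) addr0 mulrDr lerD2l.
have := IH x; rewrite (negPf xL) add0r; apply.
  by case/andP: Gp.
by case/andP: Up.
Qed.

Lemma avec_end_weight G : (0 < #|end_vertices G|)%N -> connected G ->
  avec G (end_weight G) <=
    #|T|%:R^-1 * (#|edges G|%:R / #|end_vertices G|%:R * (#|end_vertices G| + #|T|)%:R).
Proof.
move=> L0 cG; rewrite /avec ler_wpM2l ?invr_ge0 //.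
apply: (@le_trans _ _ (\sum_v #|edges G|%:R / #|end_vertices G|%:R *
     ((v \in end_vertices G)%:R + 1%:R))).
  apply: ler_sum => v _; apply: wecc_le => [|u].
    by rewrite mulr_ge0 ?divr_ge0 ?addr_ge0.
  have [p ip] := connect_is_path (connectedP u v cG).
  have [_ /(_ p ip)] := wdist_min u v (end_weight_normalised L0) cG.
  case/and3P: ip => Gp /eqP lp Up /le_trans; apply.
  apply: le_trans (end_weight_path Gp Up) _; rewrite lp ler_wpM2l ?divr_ge0 //.
  by rewrite addrC lerD2l; case: (u \in end_vertices G).
rewrite -mulr_sumr ler_wpM2l ?divr_ge0 //; under eq_bigr do rewrite -natrD.
rewrite -natr_sum big_split /= sum1_card ler_nat leq_add2r.
by rewrite -sum1_card [leqRHS]big_mkcond.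
Qed.

End WeightedDistance.

(** * The bounds for a tree and its complement *)

Theorem corollary3p5 (R : realType) (T : finType) (n : nat) (G : sgraph T)
    (cardT : #|T| = n) (n_ge4 : (4 <= n)%N) (treeG : tree G) :
  (tree (complement G) ->
     isomorphic G (path_graph 4) /\ isomorphic (complement G) (path_graph 4)
     /\ forall w w' : {set T} -> R,
          normalised G w -> normalised (complement G) w' ->
          (9 / 2 <= avec G w + avec (complement G) w' <= 6)
          /\ (81 / 16 <= avec G w * avec (complement G) w' <= 9))
  /\
  ((5 <= n)%N -> connected (complement G) -> ~ tree (complement G) ->
     let N : R := n%:R in
     let m : R := #|edges (complement G)|%:R in
     let lambda : R := (edge_connectivity (complement G))%:R in
     let lower : R := 2 * (N - 1) ^+ 2 / (N * (N - 2)) in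
     let upper : R := (N - 1) * (N + 2 * (lambda - 1)) / (2 * lambda) in
     (forall w w' : {set T} -> R,
        normalised G w -> normalised (complement G) w' ->
        (lower <= avec G w + avec (complement G) w' <= upper)
        /\ (0 <= avec G w * avec (complement G) w' <= m * (N - 1) / lambda))
     /\ (#|end_vertices G| = (n - 2)%N ->
           exists w w' : {set T} -> R,
             [/\ normalised G w, normalised (complement G) w'
               & avec G w + avec (complement G) w' = lower])
     /\ (isomorphic G (broom 3 (n - 3)) ->
           exists w w' : {set T} -> R,
             [/\ normalised G w, normalised (complement G) w'
               & avec G w + avec (complement G) w' = upper])).
Proof.
subst n; have [cG acG] := treeG.
have T1 : (1 < #|T|)%N by lia.
have T3 : (2 < #|T|)%N by lia.
have T0 : (0 < #|T|)%N by lia.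
have L0 := tree_card_end_vertices_gt0 T1 treeG.
split=> [treeG'|n_ge5 cG' ntG' N m lambda lower upper].
  have T4 := tree_cotree_card T1 treeG treeG'; have [cG' _] := treeG'.
  have leaf : exists a, a \in end_vertices G by case/card_gt0P: L0 => a La; exists a.
  have [a [b [c [d P4]]]] := exists_induced_path4 T4 cG cG' leaf.
  split; first exact: induced_path4_isomorphic P4.
  split; first exact: induced_path4_isomorphic T4 (induced_path4_complement P4).
  move=> w w' nw nw'.
  have h1 := tree_avec_ge_nondominated T3 treeG
    (fun x => nondominated_of_complement x T1 cG') nw.
  have h2 := tree_avec_ge_nondominated T3 treeG'
    (fun x => complement_nondominated x T1 cG) nw'.
  have h3 := avec_le_size T0 nw cG; have h4 := avec_le_size T0 nw' cG'.
  move: h1 h2 h3 h4; rewrite !card_edges_tree // T4 /=.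
  have -> : 2 * (4%:R - 1) ^+ 2 / (4%:R * (4%:R - 2)) = 9 / 4 :> R by field.
  by move=> h1 h2 h3 h4; split; apply/andP; split; nra.
have NE : #|edges G|%:R = N - 1 by rewrite card_edges_tree // -subn1 natrB.
have N5 : 5 <= N by rewrite ler_nat.
have mE : m = (N - 1) * (N - 2) / 2.
  have := card_edges_cotree T0 treeG => /(congr1 (fun k => k%:R : R)).
  by rewrite !natrM -subn1 !natrB // -/m -/N => H; lra.
have l1 : 1 <= lambda by rewrite ler1n edge_connectivity_gt0.
have bounds w w' : normalised G w -> normalised (complement G) w' ->
    [/\ lower <= avec G w, avec G w <= N - 1, 0 <= avec (complement G) w'
      & avec (complement G) w' <= m / lambda].
  move=> nw nw'; split.
  - exact: tree_avec_ge_nondominated (fun x => nondominated_of_complement x T1 cG') nw.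
  - by rewrite -NE avec_le_size.
  - exact: avec_ge0.
  - exact: avec_le_edge_connectivity.
have upperE : upper = N - 1 + m / lambda by rewrite /upper mE; field; lra.
split=> [w w' nw nw'|].
  have [h1 h2 h3 h4] := bounds w w' nw nw'.
  have a0 := avec_ge0 G w.
  rewrite upperE; split; apply/andP; split; [lra|lra|exact: mulr_ge0|].
  by rewrite [leRHS]mulrAC [leRHS]mulrC ler_pM.
split=> [kE|broomG].
  have [e [eG' ce]] := nontree_nonbridge cG' ntG'.
  exists (end_weight R G), (concentrated R (complement G) e).
  have nw := end_weight_normalised R L0; have nw' := concentrated_normalised R eG'.
  split=> //; have [h1 _ h3 _] := bounds _ _ nw nw'.
  have h4 := avec_nonbridge R T0 cG' eG' ce.
  have h2 := avec_end_weight R L0 cG.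
  (* The general lower bound leaves only the other inequality to check. *)
  apply/eqP; rewrite eq_le; apply/andP; split; last by lra.
  apply: le_trans (lerD h2 h4) _; rewrite addr0 NE kE natrD natrB // -/N /lower.
  by rewrite le_eqVlt; apply/orP; left; apply/eqP; field; lra.
have [c [z Gc]] := broom_complement_pendant broomG.
have [a La] := card_gt0P L0.
have [b Ga] := end_vertexP _ _ La.
exists (concentrated R G [set a; b]), (concentrated R (complement G) [set c; z]).
have eG : [set a; b] \in edges G by rewrite mem_edges Ga.
have eG' : [set c; z] \in edges (complement G) by rewrite mem_edges Gc.
have nw := concentrated_normalised R eG; have nw' := concentrated_normalised R eG'.
split=> //; have [_ h2 _ h4] := bounds _ _ nw nw'.
have h5 := avec_pendant R cG Ga; have h6 := avec_pendant R cG' Gc.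
have l1E : lambda = 1 by rewrite /lambda (edge_connectivity_pendant cG' Gc).
by rewrite upperE l1E divr1 in h4 *; rewrite NE in h5; rewrite -/m in h6; lra.
Qed.
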